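(* Let $(A,B)$ be an $n\times n$ definite pencil with eigenvalues $\lambda_1,\dots,\lambda_n\in\mathbb{R}$. Let $0<\epsilon<\min\{\sigma_n(B),\gamma(A,B)\}$, and set $$r_\epsilon=\frac{\epsilon}{\gamma(A,B)}\left[1+\left(\frac{\|A\|_2+\epsilon}{\sigma_n(B)-\epsilon}\right)^2\right],\qquad r_i=\begin{cases}\frac1{\|B\|_2},& A=0,\\ \max\left\{\frac1{\|B\|_2},\frac{|\lambda_i|}{\|A\|_2}\right\},&\text{otherwise,}\end{cases}$$ for $1\le i\le n$. Then $$\bigcup_{i=1}^n(\lambda_i-\epsilon r_i,\lambda_i+\epsilon r_i)\subseteq\Lambda^{\mathrm{sym}}_\epsilon(A,B)\subseteq\bigcup_{i=1}^n(\lambda_i-r_\epsilon,\lambda_i+r_\epsilon).$$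
   Context: A pencil $(A,B)$ of $n\times n$ complex matrices is definite if $A,B$ are Hermitian and $\gamma(A,B)=\min_{\|x\|_2=1}|x^H(A+iB)x|>0$; its eigenvalues are the roots of $\det(A-zB)$ with multiplicity. $\sigma_n(B)$ is the smallest singular value of $B$. For $\epsilon>0$, $\Lambda^{\mathrm{sym}}_\epsilon(A,B)=\{z\in\mathbb{C}:(A+E)u=z(B+F)u$ for some $u\ne0$ and Hermitian $E,F$ with $\sqrt{\|E\|_2^2+\|F\|_2^2}\le\epsilon\}$. *)

(* Defs.v *)
From HB Require Import structures.
From mathcomp Require Import all_boot all_order all_algebra.
From mathcomp Require Import all_classical all_reals.
From mathcomp Require Import complex.
Import ComplexField.Normc.
Set Implicit Arguments. Unset Strict Implicit. Unset Printing Implicit Defensive.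
Import Order.TTheory GRing.Theory Num.Theory.
Local Open Scope ring_scope.
Local Open Scope classical_set_scope.

Section Defs.
Variable R : realType.
Local Notation C := (complex R).

Definition ctrmx (m n : nat) (M : 'M[C]_(m, n)) : 'M[C]_(n, m) :=
  (map_mx (@conjc R) M)^T.

Definition hermitian (n : nat) (M : 'M[C]_n) : Prop := ctrmx M = M.

Definition vnorm (n : nat) (x : 'cV[C]_n) : R :=
  Num.sqrt (\sum_i normc (x i 0) ^+ 2).

Definition opnorm2 (m n : nat) (M : 'M[C]_(m, n)) : R :=
  sup [set vnorm (M *m x) | x in [set x : 'cV[C]_n | vnorm x = 1]].

(* smallest singular value sigma_n(B) of a square matrix: the square root of
   the smallest eigenvalue of B^H B (whose eigenvalues are real, >= 0) *)
Definition sigma_min (n : nat) (B : 'M[C]_n) : R :=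
  Num.sqrt (inf [set @complex.Re R z | z in [set z : C | eigenvalue (ctrmx B *m B) z]]).

Definition crawford (n : nat) (A B : 'M[C]_n) : R :=
  inf [set normc ((ctrmx x *m (A + (Complex 0 1) *: B) *m x) 0 0)
      | x in [set x : 'cV[C]_n | vnorm x = 1]].

Definition definite_pencil (n : nat) (A B : 'M[C]_n) : Prop :=
  hermitian A /\ hermitian B /\ 0 < crawford A B.

Definition pencil_poly (n : nat) (A B : 'M[C]_n) : {poly C} :=
  \det (map_mx polyC A - 'X *: map_mx polyC B).

Definition pencil_eigenvalues (n : nat) (A B : 'M[C]_n) (lam : 'I_n -> R) : Prop :=
  exists c : C, c != 0 /\
    pencil_poly A B = c *: \prod_(i < n) ('X - (real_complex R (lam i))%:P).

Definition sym_pseudospectrum (n : nat) (A B : 'M[C]_n) (eps : R) : set C :=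
  [set z : C | exists (u : 'cV[C]_n) (E F : 'M[C]_n),
     [/\ u != 0, hermitian E, hermitian F,
         Num.sqrt (opnorm2 E ^+ 2 + opnorm2 F ^+ 2) <= eps &
         (A + E) *m u = z *: ((B + F) *m u)]].

Definition real_interval (a b : R) : set C :=
  [set z : C | @complex.Im R z = 0 /\ a < @complex.Re R z < b].

End Defs.

(* Main.v *)
(* The left inclusion perturbs a single matrix: if A x = l B x, then t is an
   eigenvalue of (A + (t - l) B, B), and of (A + ((t - l) / l) A, B) when l <> 0.

   For the right inclusion, definiteness of the perturbed pencil makes its
   eigenvalue t real, and the unit eigenvector u satisfies
   |(A - t B) u| <= eps sqrt (1 + t^2). On the other hand, A and B are
   simultaneously diagonalized by a congruence, to diag(a_i) and diag(b_i), and
   if |a_i - t b_i| >= k |a_i + i b_i| for all i then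
   |(A - t B) u| >= k gamma(A, B) for all unit u. This replaces the usual
   rotation of the pencil to one with positive definite second matrix, and so
   does not need convexity of the numerical range. *)
Require Import Defs.
From HB Require Import structures.
From mathcomp Require Import all_boot all_order all_algebra.
From mathcomp Require Import all_classical all_reals.
From mathcomp Require Import complex.
From mathcomp Require Import ring lra.
Import ComplexField.Normc.
Import Order.TTheory GRing.Theory Num.Theory.
Local Open Scope ring_scope.
Local Open Scope classical_set_scope.

Section DefinitePencils.
Context {R : realType}.
Local Notation C := (complex R).
Local Notation "x %:C" := (real_complex R x) (format "x %:C").

(** * Complex moduli and the Cauchy-Schwarz inequality for finite real sums *)

Lemma normc_ge0 (z : C) : 0 <= normc z.
Proof. by case: z => a b; rewrite sqrtr_ge0. Qed.

Lemma normc_real (x : R) : normc x%:C = `|x|.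
Proof. by rewrite /normc /= expr0n addr0 sqrtr_sqr. Qed.

Lemma normc_conj (z : C) : normc (conjc z) = normc z.
Proof. by case: z => a b /=; rewrite sqrrN. Qed.

Lemma mulc_conj (z : C) : conjc z * z = (normc z ^+ 2)%:C.
Proof.
case: z => a b /=; rewrite sqr_sqrtr ?addr_ge0 ?sqr_ge0 //.
by apply/eqP; rewrite eq_complex /=; apply/andP; split; apply/eqP; ring.
Qed.

Lemma normc_sum (I : finType) (f : I -> C) :
  normc (\sum_i f i) <= \sum_i normc (f i).
Proof.
elim/big_ind2: _ => [|x1 y1 x2 y2 h1 h2|//]; first by rewrite normc0.
by apply: le_trans (le_normcD _ _) _; apply: lerD.
Qed.

(** Lagrange's identity: the double sum of the squares [(p i * q j - p j * q i) ^+ 2] is nonnegative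
    and equals twice the difference of the two squared sides. *)
Lemma sum_cauchy (I : finType) (p q : I -> R) :
  \sum_i p i * q i <=
  Num.sqrt (\sum_i p i ^+ 2) * Num.sqrt (\sum_i q i ^+ 2).
Proof.
have P0 : 0 <= \sum_i p i ^+ 2 by apply: sumr_ge0 => i _; apply: sqr_ge0.
rewrite -sqrtrM //; apply: le_trans (ler_norm _) _.
rewrite -sqrtr_sqr ler_wsqrtr //.
have : 0 <= \sum_i \sum_j (p i * q j - p j * q i) ^+ 2.
  by apply: sumr_ge0 => i _; apply: sumr_ge0 => j _; apply: sqr_ge0.
have -> : \sum_i \sum_j (p i * q j - p j * q i) ^+ 2 =
  \sum_i \sum_j (p i ^+ 2 * q j ^+ 2) + \sum_i \sum_j (p j ^+ 2 * q i ^+ 2)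
  - 2 * \sum_i \sum_j (p i * q i * (p j * q j)).
  rewrite mulr_sumr -sumrN -!big_split /=; apply: eq_bigr => i _.
  rewrite mulr_sumr -sumrN -!big_split /=; apply: eq_bigr => j _; ring.
rewrite [X in _ + X - _]exchange_big /= expr2 !big_distrlr /=; lra.
Qed.

(** * Conjugate transposes *)

Lemma ctrmxE {m n} (M : 'M[C]_(m, n)) i j : ctrmx M i j = conjc (M j i).
Proof. by rewrite !mxE. Qed.

Lemma ctrmxK {m n} (M : 'M[C]_(m, n)) : ctrmx (ctrmx M) = M.
Proof. by apply/matrixP => i j; rewrite !ctrmxE conjcK. Qed.

Lemma ctrmxM {m n p} (M : 'M[C]_(m, n)) (N : 'M[C]_(n, p)) :
  ctrmx (M *m N) = ctrmx N *m ctrmx M.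
Proof. by rewrite /ctrmx map_mxM trmx_mul. Qed.

Lemma ctrmxD {m n} (M N : 'M[C]_(m, n)) : ctrmx (M + N) = ctrmx M + ctrmx N.
Proof. by apply/matrixP => i j; rewrite !mxE rmorphD. Qed.

Lemma ctrmxZ {m n} (a : C) (M : 'M[C]_(m, n)) :
  ctrmx (a *: M) = conjc a *: ctrmx M.
Proof. by apply/matrixP => i j; rewrite !mxE rmorphM. Qed.

Lemma ctrmx0 {m n} : ctrmx (0 : 'M[C]_(m, n)) = 0.
Proof. by apply/matrixP => i j; rewrite !mxE rmorph0. Qed.

Lemma ctrmx1 {n} : ctrmx (1%:M : 'M[C]_n) = 1%:M.
Proof. by apply/matrixP => i j; rewrite !mxE eq_sym rmorph_nat. Qed.

Lemma ctrmx_unit {n} (M : 'M[C]_n) : (ctrmx M \in unitmx) = (M \in unitmx).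
Proof. by rewrite /ctrmx unitmx_tr map_unitmx. Qed.

Lemma ctrmx_block {m1 m2 n1 n2} (Aul : 'M[C]_(m1, n1)) (Aur : 'M_(m1, n2))
    (Adl : 'M_(m2, n1)) (Adr : 'M_(m2, n2)) :
  ctrmx (block_mx Aul Aur Adl Adr) =
  block_mx (ctrmx Aul) (ctrmx Adl) (ctrmx Aur) (ctrmx Adr).
Proof. by rewrite /ctrmx map_block_mx tr_block_mx. Qed.

Lemma ctrmx_col {m1 m2 n} (M : 'M[C]_(m1, n)) (N : 'M_(m2, n)) :
  ctrmx (col_mx M N) = row_mx (ctrmx M) (ctrmx N).
Proof. by rewrite /ctrmx map_col_mx tr_col_mx. Qed.

Lemma hermitianZ {n} (t : R) (M : 'M[C]_n) :
  Defs.hermitian M -> Defs.hermitian (t%:C *: M).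
Proof. by rewrite /Defs.hermitian ctrmxZ conjc_real => ->. Qed.

(** * The Euclidean norm *)

Lemma vnorm_ge0 {n} (x : 'cV[C]_n) : 0 <= vnorm x.
Proof. exact: sqrtr_ge0. Qed.

Lemma vnorm_sqr {n} (x : 'cV[C]_n) : vnorm x ^+ 2 = \sum_i normc (x i 0) ^+ 2.
Proof. by rewrite sqr_sqrtr // sumr_ge0 // => i _; apply: sqr_ge0. Qed.

Lemma vnorm_sqrC {n} (x : 'cV[C]_n) :
  (vnorm x ^+ 2)%:C = (ctrmx x *m x) 0 0.
Proof.
rewrite vnorm_sqr rmorph_sum mxE; apply: eq_bigr => i _.
by rewrite ctrmxE mulc_conj.
Qed.

Lemma vnorm0_eq0 {n} (x : 'cV[C]_n) : vnorm x = 0 -> x = 0.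
Proof.
move=> x0; have : vnorm x ^+ 2 == 0 by rewrite x0 expr0n.
rewrite vnorm_sqr psumr_eq0 => [|i _]; last exact: sqr_ge0.
move=> /allP h; apply/colP => i; rewrite mxE; apply: eq0_normc.
by apply/eqP; have := h i (mem_index_enum i); rewrite /= sqrf_eq0.
Qed.

Lemma vnorm_gt0 {n} (x : 'cV[C]_n) : x != 0 -> 0 < vnorm x.
Proof.
move=> x0; rewrite lt_def vnorm_ge0 andbT.
by apply: contra x0 => /eqP/vnorm0_eq0->.
Qed.

Lemma vnormZ {n} (a : C) (x : 'cV[C]_n) : vnorm (a *: x) = normc a * vnorm x.
Proof.
rewrite /vnorm -[normc a]ger0_norm ?normc_ge0 // -sqrtr_sqr -sqrtrM ?sqr_ge0 //.
congr Num.sqrt; rewrite mulr_sumr; apply: eq_bigr => i _.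
by rewrite mxE normcM exprMn.
Qed.

Lemma vnormN {n} (x : 'cV[C]_n) : vnorm (- x) = vnorm x.
Proof. by rewrite -scaleN1r vnormZ normcN normc1 mul1r. Qed.

Lemma vnormD {n} (x y : 'cV[C]_n) : vnorm (x + y) <= vnorm x + vnorm y.
Proof.
rewrite -(@ler_pXn2r _ 2) ?nnegrE ?addr_ge0 ?vnorm_ge0 // sqrrD !vnorm_sqr.
have h := sum_cauchy _ (fun i => normc (x i 0)) (fun i => normc (y i 0)).
apply: (@le_trans _ _ (\sum_i (normc (x i 0) + normc (y i 0)) ^+ 2)).
  apply: ler_sum => i _; rewrite mxE lerXn2r ?nnegrE ?addr_ge0 ?normc_ge0 //.
  exact: le_normcD.
rewrite (eq_bigr (fun i => normc (x i 0) ^+ 2 + normc (y i 0) ^+ 2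
   + 2 * (normc (x i 0) * normc (y i 0)))); last by move=> i _; ring.
by rewrite !big_split /= -mulr_sumr /vnorm; lra.
Qed.

Lemma cauchy_schwarz {n} (x y : 'cV[C]_n) :
  normc ((ctrmx y *m x) 0 0) <= vnorm y * vnorm x.
Proof.
rewrite mxE; apply: le_trans (normc_sum _ _) _; apply: le_trans (sum_cauchy _ _ _).
by apply: ler_sum => i _; rewrite normcM ctrmxE normc_conj.
Qed.

Lemma vnorm_normalize {n} (x : 'cV[C]_n) : x != 0 ->
  vnorm ((vnorm x)^-1%:C *: x) = 1.
Proof.
move=> /vnorm_gt0 x0; rewrite vnormZ normc_real ger0_norm ?invr_ge0 ?vnorm_ge0 //.
by rewrite mulVf ?gt_eqF.
Qed.

Lemma vnorm_scaleK {n} (x : 'cV[C]_n) : x != 0 ->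
  x = (vnorm x)%:C *: ((vnorm x)^-1%:C *: x).
Proof.
move=> /vnorm_gt0 x0.
by rewrite scalerA -rmorphM mulfV ?gt_eqF // rmorph1 scale1r.
Qed.

(** * The spectral norm *)

(** The Frobenius norm is an upper bound, by Cauchy-Schwarz in each row; [sup] can be compared with
    its elements only once some bound is known. *)
Lemma opnorm2_has_ubound {m n} (M : 'M[C]_(m, n)) :
  has_ubound [set vnorm (M *m x) | x in [set x : 'cV[C]_n | vnorm x = 1]].
Proof.
exists (Num.sqrt (\sum_i \sum_j normc (M i j) ^+ 2)) => _ [x /= x1 <-].
rewrite /vnorm ler_wsqrtr // ler_sum // => i _.
have S0 : 0 <= \sum_j normc (M i j) ^+ 2 by apply: sumr_ge0 => j _; apply: sqr_ge0.
rewrite -[leRHS]sqr_sqrtr // lerXn2r ?nnegrE ?normc_ge0 ?sqrtr_ge0 //.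
rewrite mxE; apply: le_trans (normc_sum _ _) _.
rewrite -[leRHS]mulr1 -x1; apply: le_trans (sum_cauchy _ _ _).
by apply: ler_sum => j _; rewrite normcM.
Qed.

Lemma opnorm2_ge0 {m n} (M : 'M[C]_(m, n)) : 0 <= opnorm2 M.
Proof.
rewrite /opnorm2; set S := [set _ | _ in _].
(* For [n = 0] there is no unit vector, and [sup] of the empty set is 0. *)
have [->|/set0P[_ [x x1 _]]] := eqVneq S set0; first by rewrite sup0.
apply: le_trans (vnorm_ge0 (M *m x)) _; apply: ub_le_sup; last by exists x.
exact: opnorm2_has_ubound.
Qed.

Lemma vnorm_mul {m n} (M : 'M[C]_(m, n)) (x : 'cV[C]_n) :
  vnorm (M *m x) <= opnorm2 M * vnorm x.
Proof.
have [->|x0] := eqVneq x 0.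
  rewrite mulmx0 -(scale0r (0 : 'cV[C]_m)) -(scale0r (0 : 'cV[C]_n)) !vnormZ.
  by rewrite normc0 !mul0r mulr0.
rewrite {1}(vnorm_scaleK x x0) -scalemxAr vnormZ normc_real.
rewrite ger0_norm ?vnorm_ge0 // mulrC ler_wpM2r ?vnorm_ge0 //.
apply: ub_le_sup; first exact: opnorm2_has_ubound.
by exists ((vnorm x)^-1%:C *: x) => //=; apply: vnorm_normalize.
Qed.

Lemma opnorm2Z_le {m n} (a : C) (M : 'M[C]_(m, n)) :
  opnorm2 (a *: M) <= normc a * opnorm2 M.
Proof.
rewrite {1}/opnorm2; set S := [set _ | _ in _].
have [->|/set0P S0] := eqVneq S set0.
  by rewrite sup0 mulr_ge0 ?normc_ge0 ?opnorm2_ge0.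
apply: ge_sup => // _ [x /= x1 <-].
rewrite -scalemxAl vnormZ ler_wpM2l ?normc_ge0 //.
by apply: le_trans (vnorm_mul _ _) _; rewrite x1 mulr1.
Qed.

Lemma opnorm2_0 {m n} : opnorm2 (0 : 'M[C]_(m, n)) = 0.
Proof.
apply: le_anti; rewrite opnorm2_ge0 andbT -(scale0r (0 : 'M[C]_(m, n))).
by apply: le_trans (opnorm2Z_le _ _) _; rewrite normc0 mul0r.
Qed.

(** * Hermitian forms and congruence *)

Definition qform {n} (M : 'M[C]_n) (x : 'cV[C]_n) : C := (ctrmx x *m M *m x) 0 0.

Lemma ctrmx_sandwich {m n} (M : 'M[C]_n) (Y : 'M[C]_(m, n)) :
  Defs.hermitian M -> Defs.hermitian (Y *m M *m ctrmx Y).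
Proof. by move=> hM; rewrite /Defs.hermitian !ctrmxM ctrmxK hM mulmxA. Qed.

Lemma hermitian_diag_real {n} (M : 'M[C]_n) (i : 'I_n) :
  Defs.hermitian M -> M i i = (complex.Re (M i i))%:C.
Proof.
move=> hM; have : M i i = conjc (M i i) by rewrite -{1}hM ctrmxE.
by case: (M i i) => a b [] hb; congr Complex; lra.
Qed.

Lemma qform_real {n} (M : 'M[C]_n) (x : 'cV[C]_n) :
  Defs.hermitian M -> qform M x = (complex.Re (qform M x))%:C.
Proof.
move=> hM; apply: hermitian_diag_real.
by rewrite -{2}(ctrmxK x); apply: ctrmx_sandwich.
Qed.

Lemma qform_ctrmx {m n} (M : 'M[C]_n) (Y : 'M[C]_(m, n)) (c : 'cV[C]_m) :
  qform M (ctrmx Y *m c) = qform (Y *m M *m ctrmx Y) c.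
Proof. by rewrite /qform ctrmxM ctrmxK !mulmxA. Qed.

(** * Simultaneous diagonalization of two Hermitian matrices by congruence *)

Lemma row_completion {n} (v : 'rV[C]_(1 + n)) : v != 0 ->
  exists W : 'M[C]_(n, 1 + n), col_mx v W \in unitmx.
Proof.
move=> v0; pose U : 'rV[C]_(1 + n) := row_mx 1%:M 0.
have Uf (f : 'M_(1 + n)) : U *m f = usubmx f.
  by rewrite -{1}(vsubmxK f) mul_row_col mul1mx mul0mx addr0.
have U0 : U != 0.
  apply/eqP => /(congr1 lsubmx) /eqP; rewrite row_mxKl linear0.
  by rewrite oner_eq0.
(* The row [U] is the first basis vector, so multiplying by it extracts the top row. The invertible
   [g] agrees with [col_mx v 0] on [U], hence has top row [v]. *)
have [|g ug] := @complete_unitmx _ _ _ U (col_mx v 0).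
  by rewrite Uf col_mxKu !rank_rV v0 U0.
rewrite !Uf col_mxKu => vg; exists (dsubmx g).
by rewrite vg vsubmxK.
Qed.

(** Induction on the size: an eigenvector of the pencil and its [B]-orthogonal complement split off
    a 1 by 1 block from both matrices at once. The last hypothesis, that the two forms have no
    common isotropic vector, passes to the complement. *)
Lemma codiagonalization {n} (A B : 'M[C]_n) :
  Defs.hermitian A -> Defs.hermitian B -> B \in unitmx ->
  (forall x : 'cV_n, x != 0 -> qform A x = 0 -> qform B x != 0) ->
  exists2 Y : 'M[C]_n, Y \in unitmx &
    is_diag_mx (Y *m A *m ctrmx Y) && is_diag_mx (Y *m B *m ctrmx Y).
Proof.
elim: n A B => [|n IHn] A B hA hB uB def.
  by exists 1%:M; [exact: unitmx1 | apply/andP; split; apply/is_diag_mxP => -[]].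
change 'M[C]_(1 + n) in A, B.
have [l /eigenvalueP[v vl v0]] := @eigenvalue_closed _ _ (A *m invmx B) (ltn0Sn n).
have vA : v *m A = l *: (v *m B).
  by have := congr1 (mulmx^~ B) vl; rewrite -scalemxAl -!mulmxA mulVmx ?mulmx1.
pose x := ctrmx v.
have x0 : x != 0.
  by apply: contra v0 => /eqP x0; rewrite -(ctrmxK v) -/x x0 ctrmx0.
have Ax : A *m x = conjc l *: (B *m x).
  by have := congr1 (@ctrmx R _ _) vA; rewrite ctrmxZ !ctrmxM hA hB.
(* On an eigenvector the form of [A] is a multiple of that of [B], so [qform B x = 0] would make [x]
   a common isotropic vector. *)
have b0 : qform B x != 0.
  apply/negP => /eqP qB; suff /(def x x0) : qform A x = 0 by rewrite qB eqxx.
  by rewrite /qform -mulmxA Ax -scalemxAr mulmxA mxE -/(qform B x) qB mulr0.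
set b := qform B x in b0.
have vBx : v *m (B *m x) = b%:M.
  by rewrite [LHS]mx11_scalar mulmxA -[v](ctrmxK v).
have [W0 uP0] := row_completion v v0.
(* A Gram-Schmidt step: multiples of [v] are subtracted from the rows of [W0] to make them
   [B]-orthogonal to [x]. This is a unitriangular row operation, so invertibility survives. *)
pose W := W0 - b^-1 *: (W0 *m B *m x) *m v.
have uP : col_mx v W \in unitmx.
  have -> : col_mx v W =
      block_mx 1%:M 0 (- (b^-1 *: (W0 *m B *m x))) 1%:M *m col_mx v W0.
    by rewrite mul_block_col !mul1mx mul0mx addr0 mulNmx addrC.
  by rewrite unitmx_mul uP0 andbT unitmxE det_lblock !det1 mulr1 unitr1.
have WBx : W *m (B *m x) = 0.
  rewrite mulmxBl -[_ *m v *m _]mulmxA vBx mul_mx_scalar scalerA mulfV // scale1r mulmxA.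
  by rewrite subrr.
have WAx : W *m (A *m x) = 0 by rewrite Ax -scalemxAr WBx scaler0.
(* The two off-diagonal blocks are conjugate transposes of each other, so they vanish together. *)
have blk (M : 'M_(1 + n)) : Defs.hermitian M -> W *m (M *m x) = 0 ->
    col_mx v W *m M *m ctrmx (col_mx v W) =
    block_mx (v *m M *m x) 0 0 (W *m M *m ctrmx W).
  move=> hM h; rewrite ctrmx_col mul_col_mx mul_col_row -/x.
  have h' : v *m M *m ctrmx W = 0.
    rewrite -[LHS]ctrmxK.
    have -> : ctrmx (v *m M *m ctrmx W) = W *m (M *m x).
      by rewrite !ctrmxM ctrmxK hM.
    by rewrite h ctrmx0.
  by rewrite h' -[W *m M *m x]mulmxA h.
have [|||y y0|Y uY /andP[dA dB]] := IHn (W *m A *m ctrmx W) (W *m B *m ctrmx W).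
- exact: ctrmx_sandwich.
- exact: ctrmx_sandwich.
- have : col_mx v W *m B *m ctrmx (col_mx v W) \in unitmx.
    by rewrite !unitmx_mul uP uB ctrmx_unit uP.
  by rewrite (blk B) // !unitmxE det_lblock unitrM => /andP[].
(* The compressed forms at [y] are the original ones at [ctrmx W *m y]. That vector is nonzero,
   being the image of [col_mx 0 y] under an invertible matrix. *)
- rewrite -!qform_ctrmx; apply: def; apply: contra y0 => /eqP h.
  have : ctrmx (col_mx v W) *m col_mx 0 y = 0.
    by rewrite ctrmx_col mul_row_col mulmx0 add0r.
  move/(congr1 (mulmx (invmx (ctrmx (col_mx v W))))).
  rewrite mulKmx ?ctrmx_unit // mulmx0 => /(congr1 dsubmx).
  by rewrite col_mxKd linear0 => ->.
pose Q : 'M[C]_(1 + n) := block_mx 1%:M 0 0 Y.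
have uQ : Q \in unitmx by rewrite unitmxE det_lblock det1 mul1r -unitmxE.
exists (Q *m col_mx v W); first by rewrite unitmx_mul uP uQ.
have fin (M : 'M_(1 + n)) : Defs.hermitian M -> W *m (M *m x) = 0 ->
    is_diag_mx (Y *m (W *m M *m ctrmx W) *m ctrmx Y) ->
    is_diag_mx ((Q *m col_mx v W) *m M *m
      ctrmx (Q *m col_mx v W)).
  move=> hM h hd; rewrite ctrmxM mulmxA -!(mulmxA Q) blk //.
  rewrite mulmxA ctrmx_block !ctrmx0 ctrmx1 !mulmx_block.
  rewrite !(mul0mx, mulmx0, addr0, add0r, mul1mx, mulmx1).
  by rewrite is_diag_block_mx // !eqxx hd /= andbT mx11_is_diag.
by apply/andP; split; apply: fin.
Qed.

Lemma codiagonalization_real {n} (A B : 'M[C]_n) :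
  Defs.hermitian A -> Defs.hermitian B -> B \in unitmx ->
  (forall x : 'cV_n, x != 0 -> qform A x = 0 -> qform B x != 0) ->
  exists (Y : 'M[C]_n) (a b : 'I_n -> R), [/\ Y \in unitmx,
    Y *m A *m ctrmx Y = diag_mx (\row_i (a i)%:C) &
    Y *m B *m ctrmx Y = diag_mx (\row_i (b i)%:C)].
Proof.
move=> hA hB uB def.
have [Y uY /andP[dA dB]] := codiagonalization A B hA hB uB def.
have diagE (M : 'M[C]_n) : Defs.hermitian M -> is_diag_mx M ->
    M = diag_mx (\row_i (complex.Re (M i i))%:C).
  move=> hM /is_diag_mxP dM; apply/matrixP => i j; rewrite !mxE.
  have [->|ij] := eqVneq i j; last by rewrite mulr0n dM.
  by rewrite mulr1n -hermitian_diag_real.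
exists Y, (fun i => complex.Re ((Y *m A *m ctrmx Y) i i)),
  (fun i => complex.Re ((Y *m B *m ctrmx Y) i i)).
split; first exact: uY.
  exact: diagE (ctrmx_sandwich _ _ hA) dA.
exact: diagE (ctrmx_sandwich _ _ hB) dB.
Qed.

(** * Forms in diagonal coordinates and the smallest singular value *)

Lemma qform_diag {n} (d : 'I_n -> C) (c : 'cV[C]_n) :
  qform (diag_mx (\row_i d i)) c = \sum_i d i * (normc (c i 0) ^+ 2)%:C.
Proof.
rewrite /qform mul_mx_diag mxE; apply: eq_bigr => i _.
by rewrite !mxE mulrAC -mulc_conj mulrC.
Qed.

Lemma qform1 {n} (x : 'cV[C]_n) : qform 1%:M x = (vnorm x ^+ 2)%:C.
Proof. by rewrite /qform mulmx1 vnorm_sqrC. Qed.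

Lemma qform_gram {n} (B : 'M[C]_n) (x : 'cV[C]_n) :
  qform (ctrmx B *m B) x = (vnorm (B *m x) ^+ 2)%:C.
Proof. by rewrite vnorm_sqrC ctrmxM /qform !mulmxA. Qed.

Lemma qformZ {n} (M : 'M[C]_n) (t : R) (x : 'cV[C]_n) :
  qform M (t%:C *: x) = (t ^+ 2)%:C * qform M x.
Proof.
rewrite /qform ctrmxZ conjc_real -!scalemxAl -scalemxAr scalerA mxE.
by rewrite -rmorphM expr2.
Qed.

Lemma qformD {n} (M N : 'M[C]_n) (x : 'cV[C]_n) :
  qform (M + N) x = qform M x + qform N x.
Proof. by rewrite /qform mulmxDr mulmxDl mxE. Qed.

Lemma qformZl {n} (a : C) (M : 'M[C]_n) (x : 'cV[C]_n) :
  qform (a *: M) x = a * qform M x.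
Proof. by rewrite /qform -scalemxAr -scalemxAl mxE. Qed.

Lemma qform_le {n} (M : 'M[C]_n) (x : 'cV[C]_n) :
  normc (qform M x) <= opnorm2 M * vnorm x ^+ 2.
Proof.
rewrite /qform -mulmxA; apply: le_trans (cauchy_schwarz _ _) _.
rewrite expr2 mulrCA ler_wpM2l ?vnorm_ge0 //; exact: vnorm_mul.
Qed.

Lemma qform_diag_real {n} (M Y : 'M[C]_n) (a : 'I_n -> R) (c : 'cV[C]_n) :
  Y *m M *m ctrmx Y = diag_mx (\row_i (a i)%:C) ->
  qform M (ctrmx Y *m c) = (\sum_i a i * normc (c i 0) ^+ 2)%:C.
Proof.
move=> dM; rewrite qform_ctrmx dM qform_diag rmorph_sum.
by apply: eq_bigr => i _; rewrite -rmorphM.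
Qed.

Lemma diag_unit_neq0 {n} (Y M : 'M[C]_n) (b : 'I_n -> R) :
  Y \in unitmx -> M \in unitmx ->
  Y *m M *m ctrmx Y = diag_mx (\row_i (b i)%:C) -> forall i, b i != 0.
Proof.
move=> uY uM dM i; have : Y *m M *m ctrmx Y \in unitmx.
  by rewrite !unitmx_mul uY uM ctrmx_unit uY.
rewrite dM unitmxE unitfE det_diag => /prodf_neq0 /(_ i isT).
by rewrite mxE; apply: contra => /eqP->.
Qed.

(** Codiagonalizing [ctrmx B *m B] with the identity stands in for the spectral theorem: the ratios
    [a i / b i] are eigenvalues of [ctrmx B *m B], so each is at least the infimum [m]. *)
Lemma sigma_min_vnorm {n} (B : 'M[C]_n) (x : 'cV[C]_n) :
  sigma_min B * vnorm x <= vnorm (B *m x).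
Proof.
rewrite /sigma_min; set S := [set _ | _ in _]; set m := inf S.
(* A nonpositive infimum has square root 0; this also covers [n = 0], where the set of eigenvalues
   is empty. *)
have [m0|m0] := lerP m 0; first by rewrite ler0_sqrtr // mul0r vnorm_ge0.
rewrite -(@ler_pXn2r _ 2) ?nnegrE ?mulr_ge0 ?sqrtr_ge0 ?vnorm_ge0 //.
rewrite exprMn sqr_sqrtr ?(ltW m0) //.
have hK : Defs.hermitian (ctrmx B *m B).
  by rewrite /Defs.hermitian ctrmxM ctrmxK.
have h1 : Defs.hermitian (1%:M : 'M[C]_n) by exact: ctrmx1.
have [||Y [a [b [uY dK d1]]]] := codiagonalization_real _ _ hK h1.
- exact: unitmx1.
- move=> y y0 _; rewrite qform1; apply/eqP => -[] /eqP.
  by rewrite sqrf_eq0 gt_eqF ?vnorm_gt0.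
have b0 := diag_unit_neq0 _ _ _ uY (unitmx1 _ _) d1.
have bE i : b i = vnorm (ctrmx (row i Y)) ^+ 2.
  apply: (@complexI R); rewrite vnorm_sqrC ctrmxK.
  have := congr1 (fun M : 'M_n => M i i) d1.
  rewrite !mxE eqxx mulr1n mulmx1 => <-.
  by apply: eq_bigr => j _; rewrite !mxE.
have b_gt0 i : 0 < b i by rewrite lt_def b0 bE sqr_ge0.
(* Cancelling [ctrmx Y] turns the two congruences into an eigenvalue relation: row [i] of [Y] is a
   left eigenvector for [a i / b i]. *)
have YK : Y *m (ctrmx B *m B) = diag_mx (\row_i (a i / b i)%:C) *m Y.
  have uY' : ctrmx Y \in unitmx by rewrite ctrmx_unit.
  apply: (can_inj (mulmxK uY')); rewrite dK -[RHS]mulmxA -{1}(mulmx1 Y) d1.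
  apply/matrixP => i j; rewrite mul_diag_mx !mxE.
  have [->|ij] := eqVneq i j; last by rewrite !mulr0n mulr0.
  by rewrite !mulr1n -rmorphM divfK.
(* For an eigenvalue [z] with eigenvector [y], the square of [vnorm (B *m y)] is [z] times that of
   [vnorm y], so [z] is nonnegative. *)
have lbS : has_lbound S.
  exists 0 => _ [z /eigenvalueP[v vK v0] <-].
  pose y := ctrmx v; have y0 : y != 0.
    by apply: contra v0 => /eqP y0; rewrite -(ctrmxK v) -/y y0 ctrmx0.
  have : (vnorm (B *m y) ^+ 2)%:C = z * (vnorm y ^+ 2)%:C.
    by rewrite -qform_gram /qform /y ctrmxK vK -scalemxAl mxE vnorm_sqrC ctrmxK.
  case: z {vK} => s t [/= + _]; rewrite mulr0 subr0 => h.
  by rewrite -(@pmulr_lge0 _ (vnorm y ^+ 2)) -?h ?sqr_ge0 ?exprn_gt0 ?vnorm_gt0.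
have mle i : m * b i <= a i.
  rewrite -ler_pdivlMr //; apply: ge_inf => //.
  exists (a i / b i)%:C => //=; apply/eigenvalueP; exists (row i Y).
    by rewrite -row_mul YK row_mul row_diag_mx -scalemxAl -rowE mxE.
  apply/eqP => h; have := b0 i.
  by rewrite bE h ctrmx0 -(scale0r (0 : 'cV_n)) vnormZ normc0 mul0r expr0n eqxx.
have -> : x = ctrmx Y *m (invmx (ctrmx Y) *m x) by rewrite mulKVmx ?ctrmx_unit.
set c := invmx _ *m x.
have -> : vnorm (ctrmx Y *m c) ^+ 2 = \sum_i b i * normc (c i 0) ^+ 2.
  by apply: (@complexI R); rewrite -qform1 (qform_diag_real _ _ _ _ d1).
have -> : vnorm (B *m (ctrmx Y *m c)) ^+ 2 = \sum_i a i * normc (c i 0) ^+ 2.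
  by apply: (@complexI R); rewrite -qform_gram (qform_diag_real _ _ _ _ dK).
rewrite mulr_sumr; apply: ler_sum => i _.
by rewrite mulrA ler_wpM2r ?sqr_ge0.
Qed.

(** * The Crawford number and a lower bound for residuals *)

Lemma crawford_qform {n} (A B : 'M[C]_n) (x : 'cV[C]_n) :
  crawford A B * vnorm x ^+ 2 <= normc (qform (A + Complex 0 1 *: B) x).
Proof.
have [->|x0] := eqVneq x 0.
  rewrite -(scale0r (0 : 'cV_n)) vnormZ normc0 mul0r expr0n mulr0.
  exact: normc_ge0.
rewrite {2}(vnorm_scaleK x x0) qformZ normcM normc_real ger0_norm ?sqr_ge0 //.
rewrite mulrC ler_wpM2l ?sqr_ge0 //; apply: ge_inf.
  by exists 0 => _ [y _ <-]; apply: normc_ge0.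
by exists ((vnorm x)^-1%:C *: x) => //; apply: vnorm_normalize.
Qed.

Lemma normc_rect (x y : R) :
  normc (x%:C + Complex 0 1 * y%:C) = Num.sqrt (x ^+ 2 + y ^+ 2).
Proof. by rewrite /= !(mul0r, mulr0, mul1r, addr0, add0r, subr0, oppr0). Qed.

Lemma sqrt_scale_le (e f x y s : R) : 0 <= s ->
  `|e| <= x * s -> `|f| <= y * s ->
  Num.sqrt (e ^+ 2 + f ^+ 2) <= Num.sqrt (x ^+ 2 + y ^+ 2) * s.
Proof.
move=> s0 he hf; rewrite -[X in _ * X](ger0_norm s0) -sqrtr_sqr.
rewrite -sqrtrM ?addr_ge0 ?sqr_ge0 // ler_wsqrtr // mulrDl -!exprMn.
have sq (u v : R) : `|u| <= v -> u ^+ 2 <= v ^+ 2.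
  move=> h; rewrite -(real_normK (num_real u)) lerXn2r ?nnegrE //.
  exact: le_trans h.
by rewrite lerD ?sq.
Qed.

(** In the application [p] and [q] are the norms of a vector and of its sign-flipped copy, and [N]
    is the residual norm. The bound on [S] by the larger of [p] and [q] is the one to use, since one
    factor of it then cancels. *)
Lemma gap_arith (k g p q S N : R) : 0 <= k -> 0 <= g -> 0 < p -> 0 <= N ->
  g * p ^+ 2 <= S -> g * q ^+ 2 <= S -> k * S <= q * N -> k * g * p <= N.
Proof.
move=> k0 g0 p0 N0 hp hq hS; have [pq|qp] := lerP p q.
  have q0 : 0 < q by exact: lt_le_trans pq.
  apply: (@le_trans _ _ (k * g * q)); first by rewrite ler_wpM2l ?mulr_ge0.
  rewrite -(ler_pM2l q0); apply: le_trans hS.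
  by rewrite mulrC -!mulrA -expr2 ler_wpM2l.
rewrite -(ler_pM2l p0); apply: (@le_trans _ _ (k * S)).
  by rewrite mulrC -!mulrA -expr2 ler_wpM2l.
by apply: le_trans hS _; rewrite ler_wpM2r // ltW.
Qed.

(* Testing [(A - z B) u] against the vector [v] obtained from [u] by flipping
   the signs of coordinates replaces the indefinite weights [a_i - z b_i] by
   their absolute values, while the Crawford bound for [u] and for [v] involves
   the same sum [S] because the coordinate moduli agree. *)
Lemma definite_pencil_gap {n} (A B Y : 'M[C]_n) (a b : 'I_n -> R) (g k z : R) :
  Y \in unitmx ->
  Y *m A *m ctrmx Y = diag_mx (\row_i (a i)%:C) ->
  Y *m B *m ctrmx Y = diag_mx (\row_i (b i)%:C) ->
  0 <= g -> 0 <= k ->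
  (forall x, g * vnorm x ^+ 2 <= normc (qform (A + Complex 0 1 *: B) x)) ->
  (forall i, k * Num.sqrt (a i ^+ 2 + b i ^+ 2) <= `|a i - z * b i|) ->
  forall u, k * g * vnorm u <= vnorm ((A - z%:C *: B) *m u).
Proof.
move=> uY dA dB g0 k0 hg hk u.
have [->|u0] := eqVneq u 0.
  by rewrite -(scale0r (0 : 'cV_n)) {1}vnormZ normc0 mul0r mulr0 vnorm_ge0.
have -> : u = ctrmx Y *m (invmx (ctrmx Y) *m u) by rewrite mulKVmx ?ctrmx_unit.
have : ctrmx Y *m (invmx (ctrmx Y) *m u) != 0 by rewrite mulKVmx ?ctrmx_unit.
set c := invmx _ *m u => /vnorm_gt0; set N := vnorm (_ *m (_ *m _)).
set w := fun i => Num.sqrt (a i ^+ 2 + b i ^+ 2).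
pose s i := a i - z * b i.
(* The value is 1, not 0, where [s i = 0], so that all coordinate moduli are preserved. *)
pose sg i : R := if 0 <= s i then 1 else -1.
pose d := \col_i ((sg i)%:C * c i 0).
(* In diagonal coordinates the form has the complex weights [a i] plus the imaginary unit times
   [b i]; the triangle inequality replaces them by their moduli [w i]. *)
have hw e : g * vnorm (ctrmx Y *m e) ^+ 2 <= \sum_i w i * normc (e i 0) ^+ 2.
  apply: le_trans (hg _) _; rewrite qformD qformZl.
  rewrite (qform_diag_real _ _ _ _ dA) (qform_diag_real _ _ _ _ dB).
  rewrite !rmorph_sum mulr_sumr -big_split /=; apply: le_trans (normc_sum _ _) _.
  apply: ler_sum => i _; rewrite !(rmorphM _ (_ i)) (mulrA (Complex 0 1)).
  rewrite -mulrDl normcM normc_real.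
  rewrite [`|_ ^+ 2|]ger0_norm ?sqr_ge0 // ler_wpM2r ?sqr_ge0 //.
  by rewrite normc_rect.
have hd i : normc (d i 0) = normc (c i 0).
  rewrite mxE normcM normc_real /sg.
  by case: ifP => _; rewrite ?normrN normr1 mul1r.
have hwd := hw d.
rewrite (eq_bigr (fun i => w i * normc (c i 0) ^+ 2)) in hwd; last first.
  by move=> i _; rewrite hd.
have {}hw := hw c; set S := \sum_i _ in hw hwd.
set p := vnorm (ctrmx Y *m c) in hw *; set q := vnorm (ctrmx Y *m d) in hwd *.
move=> p0.
have hS : k * S <= q * N.
  have -> : q * N = vnorm (ctrmx Y *m d) * N by [].
  apply: le_trans (cauchy_schwarz _ _); rewrite ctrmxM ctrmxK.
  have -> : ctrmx d *m Y *m ((A - z%:C *: B) *m (ctrmx Y *m c)) =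
      ctrmx d *m (Y *m (A - z%:C *: B) *m ctrmx Y) *m c by rewrite !mulmxA.
  have -> : Y *m (A - z%:C *: B) *m ctrmx Y = diag_mx (\row_i (s i)%:C).
    rewrite mulmxBr mulmxBl -scalemxAr -scalemxAl dA dB.
    apply/matrixP => i j; rewrite !mxE; have [->|_] := eqVneq i j.
      by rewrite !mulr1n rmorphB rmorphM.
    by rewrite !mulr0n mulr0 subr0.
  rewrite mxE (eq_bigr (fun i => (`|s i| * normc (c i 0) ^+ 2)%:C)); last first.
    move=> i _.
    have -> : (ctrmx d *m diag_mx (\row_j (s j)%:C)) 0 i =
        conjc (d i 0) * (s i)%:C by rewrite mul_mx_diag !mxE.
    have -> : conjc (d i 0) = (sg i)%:C * conjc (c i 0).
      by rewrite [d i 0]mxE rmorphM -[X in X * _]/(conjc _) conjc_real.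
    transitivity (`|s i|%:C * (conjc (c i 0) * c i 0)).
      have -> : `|s i| = sg i * s i.
        rewrite /sg; case: ifPn => [h|]; first by rewrite mul1r ger0_norm.
        by rewrite -ltNge => h; rewrite mulN1r ltr0_norm.
      by rewrite rmorphM; ring.
    by rewrite mulc_conj -rmorphM.
  rewrite -rmorph_sum normc_real; apply: le_trans (ler_norm _).
  rewrite mulr_sumr; apply: ler_sum => i _.
  by rewrite mulrA ler_wpM2r ?sqr_ge0 // hk.
by apply: (gap_arith _ _ _ _ _ _ k0 g0 p0 _ hw hwd hS); apply: vnorm_ge0.
Qed.

(** * Eigenvalues of the pencil and their distance to a real point *)

Lemma horner_pencil_poly {n} (A B : 'M[C]_n) (z : C) :
  (pencil_poly A B).[z] = \det (A - z *: B).
Proof.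
rewrite /pencil_poly -[LHS]/(horner_eval z _) -det_map_mx; congr (\det _).
by apply/matrixP => i j; rewrite !mxE -[LHS]/(horner _ _) !hornerE.
Qed.

Lemma pencil_eigenvaluesP {n} (A B : 'M[C]_n) (lam : 'I_n -> R) (z : C) :
  pencil_eigenvalues A B lam ->
  reflect (exists i, z = (lam i)%:C) (\det (A - z *: B) == 0).
Proof.
move=> hlam; apply: (iffP idP); case: hlam => c [c0 e];
  rewrite -horner_pencil_poly e hornerZ horner_prod mulf_eq0 (negbTE c0) /=.
  move=> /prodf_eq0[i _]; rewrite hornerXsubC subr_eq0 => /eqP ->; by exists i.
by move=> [i ->]; apply/prodf_eq0; exists i => //; rewrite hornerXsubC subrr.
Qed.

Lemma pencil_eigenvector {n} (A B : 'M[C]_n) (lam : 'I_n -> R) (i : 'I_n) :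
  pencil_eigenvalues A B lam ->
  exists2 x : 'cV_n, x != 0 & A *m x = (lam i)%:C *: (B *m x).
Proof.
move=> hlam; have : \det (A - (lam i)%:C *: B) == 0.
  by apply/(pencil_eigenvaluesP _ _ _ _ hlam); exists i.
(* [det0P] gives a row in the left kernel, hence the detour through the transpose. *)
rewrite -det_tr => /det0P[v v0 h]; exists v^T.
  by apply: contra v0 => /eqP h0; rewrite -(trmxK v) h0 trmx0.
apply/eqP; rewrite -subr_eq0 scalemxAl -mulmxBl; apply/eqP/trmx_inj.
by rewrite trmx_mul trmxK h trmx0.
Qed.

Lemma sigma_min_unit {n} (B : 'M[C]_n) : 0 < sigma_min B -> B \in unitmx.
Proof.
move=> s0; rewrite unitmxE unitfE -det_tr; apply/negP => /det0P[v v0 h].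
have : v^T != 0 by apply: contra v0 => /eqP h0; rewrite -(trmxK v) h0 trmx0.
move=> /vnorm_gt0 v1; have := sigma_min_vnorm B v^T.
rewrite -[B *m _]trmxK trmx_mul trmxK h trmx0.
rewrite -(scale0r (0 : 'cV_n)) [leRHS]vnormZ normc0 mul0r leNgt.
by rewrite mulr_gt0.
Qed.

(** For an eigenvector [x], the vector [A *m x] has norm at most [opnorm2 A * vnorm x] and at least
    [|lam i| * sigma_min B * vnorm x]. *)
Lemma pencil_eigenvalue_le {n} (A B : 'M[C]_n) (lam : 'I_n -> R) (i : 'I_n) :
  pencil_eigenvalues A B lam -> 0 < sigma_min B ->
  `|lam i| <= opnorm2 A / sigma_min B.
Proof.
move=> hlam s0; have [x /vnorm_gt0 x0 Ax] := pencil_eigenvector _ _ _ i hlam.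
rewrite ler_pdivlMr // -(ler_pM2r x0).
apply: le_trans (vnorm_mul A x); rewrite Ax vnormZ normc_real -mulrA.
by rewrite ler_wpM2l // sigma_min_vnorm.
Qed.

(** Each [a i / b i] is some [lam j], so [|a i - t * b i|] is at least [r * |b i|], while the
    modulus of the pair [a i], [b i] is [sqrt (1 + lam j ^+ 2) * |b i|]. Bounding [|lam j|] by [m]
    gives the gap constant [k = r / sqrt (1 + m ^+ 2)]. *)
Lemma definite_pencil_nearest {n} (A B : 'M[C]_n) (lam : 'I_n -> R) (r t : R)
    (u : 'cV[C]_n) :
  definite_pencil A B -> pencil_eigenvalues A B lam -> 0 < sigma_min B ->
  0 <= r -> (forall i, r <= `|lam i - t|) ->
  r * crawford A B * vnorm u <=
  Num.sqrt (1 + (opnorm2 A / sigma_min B) ^+ 2) *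
  vnorm ((A - t%:C *: B) *m u).
Proof.
move=> [hA [hB g0]] hlam s0 r0 hr.
have uB := sigma_min_unit B s0.
have [|Y [a [b [uY dA dB]]]] := codiagonalization_real A B hA hB uB.
  move=> x /vnorm_gt0 x0 qA; apply/eqP => qB.
  have := crawford_qform A B x; rewrite qformD qformZl qA qB mulr0 addr0 normc0.
  by rewrite leNgt mulr_gt0 ?exprn_gt0.
set m := opnorm2 A / sigma_min B; set sm := Num.sqrt _.
have sm0 : 0 < sm by rewrite sqrtr_gt0 ltr_pwDl ?sqr_ge0.
have b0 := diag_unit_neq0 _ _ _ uY uB dB.
have ab i : exists j, a i = lam j * b i.
  have : \det (A - (a i / b i)%:C *: B) == 0.
    have : \det (Y *m (A - (a i / b i)%:C *: B) *m ctrmx Y) == 0.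
      rewrite mulmxBr mulmxBl -scalemxAr -scalemxAl dA dB -linearZ -linearB /=.
      rewrite det_diag; apply/prodf_eq0; exists i => //.
      by rewrite !mxE -rmorphM divfK // subrr.
    rewrite !det_mulmx !mulf_eq0 => /orP[/orP[|//]|]; apply: contraLR => _.
      by rewrite -unitfE -unitmxE.
    by rewrite -unitfE -unitmxE ctrmx_unit.
  move=> /(pencil_eigenvaluesP _ _ _ _ hlam)[j [hj]]; exists j.
  by rewrite -hj divfK.
have hk i : r / sm * Num.sqrt (a i ^+ 2 + b i ^+ 2) <= `|a i - t * b i|.
  have [j ->] := ab i; rewrite -mulrBl normrM.
  have -> : (lam j * b i) ^+ 2 + b i ^+ 2 = (1 + lam j ^+ 2) * b i ^+ 2 by ring.
  rewrite sqrtrM ?addr_ge0 ?sqr_ge0 // sqrtr_sqr mulrA ler_wpM2r //.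
  apply: le_trans (hr j); rewrite mulrAC ler_pdivrMr // ler_wpM2l //.
  rewrite ler_wsqrtr // lerD2l -[lam j ^+ 2]real_normK ?num_real //.
  rewrite lerXn2r ?nnegrE ?divr_ge0 ?opnorm2_ge0 ?(ltW s0) //.
  exact: pencil_eigenvalue_le.
have := definite_pencil_gap A B Y a b _ _ t uY dA dB (ltW g0)
  (divr_ge0 r0 (ltW sm0)) (crawford_qform A B) hk u.
rewrite -(ler_pM2l sm0) => h; apply: le_trans h.
by rewrite !mulrA [sm * r]mulrC mulfK ?gt_eqF.
Qed.

(** * Points of the symmetric pseudospectrum *)

(** [z] is a quotient of two real form values unless [qform (B + F) u = 0]. In that case
    [qform (A + E) u = 0] too, so the Crawford form at [u] has the modulus of the same form in [E]
    and [F], at most [eps * vnorm u ^+ 2], which is too small. *)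
Lemma sym_pseudospectrum_real {n} (A B E F : 'M[C]_n) (u : 'cV[C]_n) (z : C)
    (eps : R) :
  Defs.hermitian A -> Defs.hermitian B -> Defs.hermitian E -> Defs.hermitian F ->
  u != 0 -> Num.sqrt (opnorm2 E ^+ 2 + opnorm2 F ^+ 2) <= eps ->
  eps < crawford A B -> (A + E) *m u = z *: ((B + F) *m u) ->
  exists t : R, z = t%:C.
Proof.
move=> hA hB hE hF /vnorm_gt0 u0 hEF eg hz.
have eps0 : 0 <= eps by apply: le_trans hEF; apply: sqrtr_ge0.
have hq : qform (A + E) u = z * qform (B + F) u.
  by rewrite /qform -!mulmxA hz -scalemxAr mxE.
have [b0|b0] := eqVneq (qform (B + F) u) 0; last first.
  exists (complex.Re (qform (A + E) u) / complex.Re (qform (B + F) u)).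
  have hAE : Defs.hermitian (A + E) by rewrite /Defs.hermitian ctrmxD hA hE.
  have hBF : Defs.hermitian (B + F) by rewrite /Defs.hermitian ctrmxD hB hF.
  apply: (mulIf b0); rewrite -hq {1}(qform_real _ _ hAE).
  rewrite [in RHS](qform_real _ _ hBF) -rmorphM divfK //.
  by apply: contra b0 => /eqP h; rewrite (qform_real _ _ hBF) h.
move: hq; rewrite b0 mulr0 qformD => /eqP; rewrite addr_eq0 => /eqP qA.
move: b0; rewrite qformD => /eqP; rewrite addr_eq0 => /eqP qB.
have := crawford_qform A B u; rewrite qformD qformZl qA qB mulrN -opprD normcN.
set p := vnorm u in u0 *.
have := qform_le E u; have := qform_le F u; rewrite -/p.
rewrite (qform_real E) // (qform_real F) // !normc_real.
move: (complex.Re _) => f; move: (complex.Re _) => e hf he.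
rewrite leNgt => /negP[]; apply: (@le_lt_trans _ _ (eps * p ^+ 2)); last first.
  by rewrite ltr_pM2r ?exprn_gt0.
rewrite normc_rect; apply: (@le_trans _ _
  (Num.sqrt (opnorm2 E ^+ 2 + opnorm2 F ^+ 2) * p ^+ 2)).
  exact: (sqrt_scale_le _ _ _ _ _ (sqr_ge0 _) he hf).
by rewrite ler_wpM2r ?sqr_ge0.
Qed.

Lemma sym_pseudospectrum_shiftB {n} (A B : 'M[C]_n) (x : 'cV[C]_n) (l t eps : R) :
  Defs.hermitian B -> x != 0 -> A *m x = l%:C *: (B *m x) ->
  `|t - l| * opnorm2 B <= eps -> sym_pseudospectrum A B eps t%:C.
Proof.
move=> hB x0 Ax h; exists x, ((t - l)%:C *: B), 0; split=> //.
- exact: hermitianZ.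
- exact: ctrmx0.
- rewrite opnorm2_0 expr0n addr0 sqrtr_sqr ger0_norm ?opnorm2_ge0 //.
  by apply: le_trans (opnorm2Z_le _ _) _; rewrite normc_real.
rewrite addr0 mulmxDl Ax -scalemxAl -scalerDl -rmorphD; congr (_%:C *: _); ring.
Qed.

Lemma sym_pseudospectrum_shiftA {n} (A B : 'M[C]_n) (x : 'cV[C]_n) (l t eps : R) :
  Defs.hermitian A -> x != 0 -> l != 0 -> A *m x = l%:C *: (B *m x) ->
  `|t - l| / `|l| * opnorm2 A <= eps -> sym_pseudospectrum A B eps t%:C.
Proof.
move=> hA x0 l0 Ax h; exists x, (((t - l) / l)%:C *: A), 0; split=> //.
- exact: hermitianZ.
- exact: ctrmx0.
- rewrite opnorm2_0 expr0n addr0 sqrtr_sqr ger0_norm ?opnorm2_ge0 //.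
  by apply: le_trans (opnorm2Z_le _ _) _; rewrite normc_real normf_div.
rewrite addr0 mulmxDl -scalemxAl Ax scalerA -scalerDl -rmorphM -rmorphD.
by congr (_%:C *: _); rewrite divfK //; ring.
Qed.

Lemma sym_pseudospectrum_residual {n} (A B E F : 'M[C]_n) (u : 'cV[C]_n)
    (t eps : R) :
  u != 0 -> Num.sqrt (opnorm2 E ^+ 2 + opnorm2 F ^+ 2) <= eps ->
  eps < sigma_min B -> (A + E) *m u = t%:C *: ((B + F) *m u) ->
  vnorm ((A - t%:C *: B) *m u) <=
    eps * Num.sqrt (1 + ((opnorm2 A + eps) / (sigma_min B - eps)) ^+ 2) * vnorm u.
Proof.
move=> /vnorm_gt0 u0 hEF es hz.
have [hE hF] : opnorm2 E <= eps /\ opnorm2 F <= eps.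
  split; apply: le_trans hEF; rewrite -[leLHS](ger0_norm (opnorm2_ge0 _)).
    by rewrite -sqrtr_sqr; apply: ler_wsqrtr; rewrite lerDl sqr_ge0.
  by rewrite -sqrtr_sqr; apply: ler_wsqrtr; rewrite lerDr sqr_ge0.
have s0 : 0 < sigma_min B - eps by rewrite subr_gt0.
(* This is the eigenvalue bound for the perturbed pencil: [A + E] has norm at most
   [opnorm2 A + eps], and [B + F] shrinks [u] by a factor no smaller than [sigma_min B - eps]. *)
have ht : `|t| <= (opnorm2 A + eps) / (sigma_min B - eps).
  rewrite ler_pdivlMr // -(ler_pM2r u0).
  have hA : vnorm ((A + E) *m u) <= (opnorm2 A + eps) * vnorm u.
    rewrite mulmxDl mulrDl; apply: le_trans (vnormD _ _) _.
    apply: lerD; first exact: vnorm_mul.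
    exact: le_trans (vnorm_mul E u) (ler_wpM2r (vnorm_ge0 u) hE).
  apply: le_trans hA; rewrite hz vnormZ normc_real -mulrA ler_wpM2l //.
  rewrite mulrBl lerBlDr; apply: le_trans (sigma_min_vnorm B u) _.
  have -> : B *m u = (B + F) *m u + - (F *m u) by rewrite mulmxDl addrK.
  apply: le_trans (vnormD _ _) _; rewrite lerD2l vnormN.
  exact: le_trans (vnorm_mul F u) (ler_wpM2r (vnorm_ge0 u) hF).
have -> : (A - t%:C *: B) *m u = t%:C *: (F *m u) + - (E *m u).
  apply/eqP; rewrite -subr_eq0; apply/eqP.
  transitivity ((A + E) *m u - t%:C *: ((B + F) *m u)); last by rewrite hz subrr.
  rewrite !mulmxDl mulNmx -scalemxAl scalerDr !opprD opprK -!addrA.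
  by congr (_ + _); rewrite [RHS]addrC addrA.
apply: le_trans (vnormD _ _) _; rewrite vnormN vnormZ normc_real.
apply: (@le_trans _ _ ((`|t| * opnorm2 F + 1 * opnorm2 E) * vnorm u)).
  rewrite mul1r mulrDl -mulrA lerD ?vnorm_mul // ler_wpM2l //; exact: vnorm_mul.
rewrite ler_wpM2r ?vnorm_ge0 //.
apply: le_trans (_ : Num.sqrt (1 + `|t| ^+ 2) *
  Num.sqrt (opnorm2 E ^+ 2 + opnorm2 F ^+ 2) <= _).
  (* Cauchy-Schwarz for two terms, indexed by [bool]. *)
  have := @sum_cauchy bool (fun b => if b then `|t| else 1)
    (fun b => if b then opnorm2 F else opnorm2 E).
  rewrite !big_bool /= expr1n => h; apply: le_trans h _.
  rewrite [X in Num.sqrt X * _ <= _]addrC [X in _ * Num.sqrt X <= _]addrC.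
  exact: lexx.
rewrite mulrC; apply: ler_pM; rewrite ?sqrtr_ge0 //.
by rewrite ler_wsqrtr // lerD2l lerXn2r ?nnegrE // (le_trans _ ht).
Qed.

End DefinitePencils.

(** * The two inclusions *)

Theorem theorem2p6 (R : realType) (n : nat) (A B : 'M[complex R]_n)
  (lam : 'I_n -> R) (eps : R) :
  definite_pencil A B ->
  pencil_eigenvalues A B lam ->
  0 < eps -> eps < Num.min (sigma_min B) (crawford A B) ->
  let r_eps := eps / crawford A B *
      (1 + ((opnorm2 A + eps) / (sigma_min B - eps)) ^+ 2) in
  let r := fun i : 'I_n =>
      if A == 0 then (opnorm2 B)^-1
      else Num.max (opnorm2 B)^-1 (`|lam i| / opnorm2 A) in
  \bigcup_i real_interval (lam i - eps * r i) (lam i + eps * r i)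
    `<=` sym_pseudospectrum A B eps /\
  sym_pseudospectrum A B eps
    `<=` \bigcup_i real_interval (lam i - r_eps) (lam i + r_eps).
Proof.
move=> hdef hlam eps0; rewrite lt_min => /andP[es eg] r_eps r.
have [hA [hB g0]] := hdef; have s0 := lt_trans eps0 es; split.
  move=> z [i _ [Im0 zi]].
  have -> : z = real_complex R (complex.Re z) by case: z Im0 {zi} => a b /= ->.
  have {zi} : `|complex.Re z - lam i| < eps * r i by rewrite ltr_distl.
  move: (complex.Re z) => t; rewrite /r.
  have [x x0 Ax] := pencil_eigenvector _ _ _ i hlam.
  have shiftB : `|t - lam i| < eps * (opnorm2 B)^-1 ->
      sym_pseudospectrum A B eps (real_complex R t).
    move=> h; apply: (sym_pseudospectrum_shiftB A B x (lam i)) => //.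
    have := opnorm2_ge0 B; rewrite le_eqVlt => /predU1P[<-|B0].
      by rewrite mulr0 ltW.
    by rewrite -ler_pdivlMr // ltW.
  case: ifP => [_|_]; first exact: shiftB.
  rewrite maxr_pMr ?(ltW eps0) // lt_max => /orP[|h]; first exact: shiftB.
  (* For [lam i = 0] the strict bound [h] would put an absolute value below 0. *)
  have l0 : lam i != 0.
    apply/eqP => l0; move: h.
    by rewrite l0 normr0 mul0r mulr0 ltNge normr_ge0.
  apply: (sym_pseudospectrum_shiftA A B x (lam i)) => //.
  have := opnorm2_ge0 A; rewrite le_eqVlt => /predU1P[<-|A0].
    by rewrite mulr0 ltW.
  rewrite -ler_pdivlMr // ler_pdivrMr ?normr_gt0 // mulrAC -mulrA ltW //.
move=> z [u [E [F [u0 hE hF hEF hz]]]].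
have [t zt] := sym_pseudospectrum_real A B E F u z eps hA hB hE hF u0 hEF eg hz.
rewrite zt in hz *.
(* Otherwise every eigenvalue is at distance at least [r_eps] from [t], and the lower and upper
   bounds for the residual of [u] will clash. *)
have [[i hi]|hn] := pselect (exists i, `|lam i - t| < r_eps).
  by exists i => //; split=> //=; rewrite -ltr_distl distrC.
have hr i : r_eps <= `|lam i - t|.
  by rewrite leNgt; apply/negP => h; apply: hn; exists i.
have r0 : 0 <= r_eps.
  by rewrite mulr_ge0 ?divr_ge0 ?(ltW eps0) ?(ltW g0) // addr_ge0 ?sqr_ge0.
have lower := definite_pencil_nearest A B lam r_eps t u hdef hlam s0 r0 hr.
have upper := sym_pseudospectrum_residual A B E F u t eps u0 hEF es hz.
set p := vnorm u in lower upper; have p0 : 0 < p := vnorm_gt0 _ u0.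
set m := opnorm2 A / sigma_min B in lower.
(* The strictness of this comparison makes the final contradiction possible, and so yields open
   intervals. *)
have mM : m < (opnorm2 A + eps) / (sigma_min B - eps).
  rewrite /m ltr_pdivrMr // mulrAC ltr_pdivlMr ?subr_gt0 //.
  apply: (@le_lt_trans _ _ (opnorm2 A * sigma_min B)).
    by rewrite ler_wpM2l ?opnorm2_ge0 // gerBl ltW.
  by rewrite ltr_pM2r // ltrDl.
have m0 : 0 <= m by rewrite divr_ge0 ?opnorm2_ge0 ?(ltW s0).
move: lower upper; rewrite /r_eps; set M := _ / (_ - eps) in mM *.
move=> lower upper; exfalso; move: lower; apply/negP; rewrite -ltNge.
apply: le_lt_trans (ler_wpM2l (sqrtr_ge0 _) upper) _.
have M0 : 0 <= M by rewrite ltW // (le_lt_trans m0).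
have bM : 0 < Num.sqrt (1 + M ^+ 2) by rewrite sqrtr_gt0 ltr_pwDl ?sqr_ge0.
(* The factor [1 + M ^+ 2] of [r_eps] splits into two square roots: one matches the residual bound,
   the other is compared with [sqrt (1 + m ^+ 2)]. *)
have -> : eps / crawford A B * (1 + M ^+ 2) * crawford A B * p =
    Num.sqrt (1 + M ^+ 2) * (eps * Num.sqrt (1 + M ^+ 2) * p).
  rewrite -[1 + M ^+ 2 in LHS]sqr_sqrtr ?addr_ge0 ?sqr_ge0 //.
  by field; rewrite gt_eqF.
rewrite ltr_pM2r ?mulr_gt0 // ltr_sqrt ?(ltr_pwDl ltr01 (sqr_ge0 _)) //.
by rewrite ltrD2l ltrXn2r ?nnegrE.
Qed.
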